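(* Every $(k,t)$-simple finite ordered binary structure has twin-width at most $2^{2^{\mathcal O(kt)}}$.
   Context: A binary structure is a structure over a finite relational signature $\Sigma$ with symbols of arity at most 2; ordered means $\Sigma$ contains $\le$ interpreted as a total order. For $R\in\Sigma$ binary, $a\in S$ and $B\subseteq S$, let $\mathrm{tp}^R(a/B)=\{b\in B: S\models R(a,b)\}$, and for $A,B\subseteq S$ let $\mathrm{Types}_\Sigma(A/B)=\{\mathrm{tp}^R(a/B): a\in A, R\in\Sigma\}$. A convex partition is a partition into intervals of the order. $S$ is $(k,t)$-simple if for every pair of convex partitions $\mathcal L,\mathcal R$ of $S$ with $|\mathcal L|=|\mathcal R|\ge t$ there are $L\in\mathcal L$, $R\in\mathcal R$ with $|\mathrm{Types}_\Sigma(L/R)|\le k$ and $|\mathrm{Types}_\Sigma(R/L)|\le k$. Twin-width: disjoint $X,Y\subseteq S$ are homogeneous if for every binary $R\in\Sigma$ the truth value of $R(x,y)$ is constant over $X\times Y$ and that of $R(y,x)$ as well; a contraction sequence is a sequence of partitions from the one-part partition to singletons, each step splitting one part into two; its red-degree is the max over its partitions of the max number of other parts a part is non-homogeneous with; the twin-width is the least red-degree of a contraction sequence. *)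

(* Defs.v *)
From mathcomp Require Import all_boot.
From mathcomp Require Import boolp.

Set Implicit Arguments.
Unset Strict Implicit.
Unset Printing Implicit Defensive.

(** A finite relational signature with symbols of arity at most 2 is given by
    its finite sets of symbols of each arity; it is ordered when one of the
    binary symbols is designated as the order symbol. *)
Record ordSignature := OrdSignature {
  nullary_symbol : finType;
  unary_symbol : finType;
  binary_symbol : finType;
  order_symbol : binary_symbol
}.

Definition is_total_order (T : Type) (r : rel T) : Prop :=
  [/\ reflexive r, antisymmetric r, transitive r & total r].

(** The carrier may be empty. *)
Record ordStructure (Sigma : ordSignature) := OrdStructure {
  carrier :> finType;
  nullary_rel : nullary_symbol Sigma -> bool;
  unary_rel : unary_symbol Sigma -> pred carrier;
  binary_rel : binary_symbol Sigma -> rel carrier;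
  order_symbolP : is_total_order (binary_rel (order_symbol Sigma))
}.

Section Notions.

Variables (Sigma : ordSignature) (S : ordStructure Sigma).
Implicit Types (A B X Y : {set S}) (P Q : {set {set S}}).
Implicit Types (s : seq {set {set S}}).

Definition ord_le : rel S := @binary_rel Sigma S (order_symbol Sigma).

Definition tp (R : binary_symbol Sigma) (a : S) B : {set S} :=
  [set b in B | binary_rel R a b].

(** Types of different symbols that are equal as sets are identified. *)
Definition Types A B : {set {set S}} :=
  [set tp R a B | R : binary_symbol Sigma, a : S in A].

Definition convex A : bool :=
  [forall x in A, forall z in A, forall y : S,
     ord_le x y && ord_le y z ==> (y \in A)].

Definition convex_partition P : bool :=
  partition P [set: S] && [forall A in P, convex A].

Definition simple (k t : nat) : Prop :=
  forall L R : {set {set S}},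
    convex_partition L -> convex_partition R ->
    #|L| = #|R| -> t <= #|L| ->
  exists A B : {set S},
    [/\ A \in L, B \in R, #|Types A B| <= k & #|Types B A| <= k].

Definition homogeneous X Y : bool :=
  [forall R : binary_symbol Sigma,
   forall x in X, forall x' in X, forall y in Y, forall y' in Y,
     (binary_rel R x y == binary_rel R x' y') &&
     (binary_rel R y x == binary_rel R y' x')].

Definition partition_red_degree P : nat :=
  \max_(X in P) #|[set Y in P | (Y != X) && ~~ homogeneous X Y]|.

(** When the carrier is empty, its only partition has no part at all. *)
Definition one_part : {set {set S}} := [set [set: S]] :\ set0.

Definition singletons : {set {set S}} := [set [set x] | x : S].

Definition splits P Q : bool :=
  [exists A in P, exists B : {set S},
    [&& B != set0, B \proper A & Q == B |: ((A :\: B) |: (P :\ A))]].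

Definition contraction_sequence s : bool :=
  if s is P :: s' then
    [&& all (fun Q => partition Q [set: S]) s, P == one_part,
        path splits P s' & last P s' == singletons]
  else false.

Definition red_degree s : nat := \max_(P <- s) partition_red_degree P.

Lemma one_part_partition : partition one_part [set: S].
Proof.
rewrite /partition /one_part !inE eqxx /= andbT; apply/andP; split.
  rewrite eqEsubset subsetT /=; apply/subsetP => x _.
  apply/bigcupP; exists [set: S]; rewrite !inE ?eqxx ?andbT //.
  by apply/set0Pn; exists x; rewrite inE.
apply/trivIsetP => A B; rewrite !inE => /andP[_ /eqP->] /andP[_ /eqP->].
by rewrite eqxx.
Qed.

Lemma splits_partition P Q :
  partition P [set: S] -> splits P Q -> partition Q [set: S].
Proof.
move=> pP /existsP[A /andP[AP /existsP[B /and3P[B0 BA /eqP ->]]]].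
have D0 : A :\: B != set0.
  by rewrite setD_eq0; case/properP: BA => _ [x xA xB]; apply/subsetPn; exists x.
have [covP trP P0] := and3P pP.
have pD : partition (P :\ A) ([set: S] :\: A) by apply: partitionD1.
have pDB : partition ((A :\: B) |: (P :\ A)) ((A :\: B) :|: ([set: S] :\: A)).
  apply: partitionU1 => //.
  by rewrite -setI_eq0; apply/eqP/setP => x; rewrite !inE; case: (x \in A); rewrite ?andbF.
have -> : [set: S] = B :|: ((A :\: B) :|: ([set: S] :\: A)).
  apply/setP => x; rewrite !inE.
  by case: (x \in A); case: (x \in B).
apply: partitionU1 => //.
rewrite -setI_eq0; apply/eqP/setP => x; rewrite !inE.
case xB: (x \in B) => //=.
by rewrite (subsetP (proper_sub BA)).
Qed.

Lemma splitting_path_exists P :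
  partition P [set: S] ->
  exists s, [/\ all (fun Q => partition Q [set: S]) s,
                path splits P s & last P s = singletons].
Proof.
have [n] := ubnP #|[set x : S | [set x] \notin P]|.
elim: n P => // n IHn P; rewrite ltnS => lePn pP.
have [covP trP P0] := and3P pP.
have covx x : exists2 A, A \in P & x \in A.
  have : x \in cover P by rewrite (eqP covP) inE.
  by case/bigcupP => A; exists A.
have [eq0|[x]] := set_0Vmem [set x : S | [set x] \notin P].
  exists [::]; split => //=; apply/setP => A.
  have sP x : [set x] \in P.
    by have := in_set0 x; rewrite -eq0 inE => /negbFE.
  apply/idP/imsetP => [AP | [x _ ->] //].
  have /set0Pn[x xA] : A != set0 by apply: contraNneq P0 => <-.
  exists x => //; apply: contraTeq xA => neq.
  have := trivIsetP trP A [set x] AP (sP x) neq.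
  by rewrite disjoint_sym disjoints1.
rewrite inE => xP; have [A AP xA] := covx x.
have AnX : A != [set x] by apply: contraNneq xP => <-.
pose Q := [set x] |: ((A :\: [set x]) |: (P :\ A)).
have spl : splits P Q.
  apply/existsP; exists A; rewrite AP; apply/existsP; exists [set x].
  rewrite eqxx andbT properEneq [_ == A]eq_sym AnX sub1set xA !andbT.
  by apply/set0Pn; exists x; rewrite inE.
have pQ := splits_partition pP spl.
have ltQ : #|[set y : S | [set y] \notin Q]| < n.
  apply: leq_trans lePn; apply: proper_card; apply/properP; split.
    apply/subsetP => y; rewrite !inE !negb_or => /and3P[nyx _].
    have [yA|_] := eqVneq [set y] A; last by [].
    case/negP: nyx; rewrite eq_sym; apply/eqP; congr set1.
    by move: xA; rewrite -yA inE => /eqP.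
  by exists x; rewrite !inE ?xP // eqxx.
have [s [alls ps ls]] := IHn Q ltQ pQ.
by exists (Q :: s); split; rewrite /= ?pQ ?spl.
Qed.

(** [`[< _ >]] turns the proposition into a boolean, as [ex_minn] expects. *)
Lemma contraction_sequence_exists :
  exists d, `[< exists2 s, contraction_sequence s & red_degree s = d >].
Proof.
have [s [alls ps ls]] := splitting_path_exists one_part_partition.
exists (red_degree (one_part :: s)); apply/asboolP; exists (one_part :: s) => //.
by rewrite /= one_part_partition alls ps ls !eqxx.
Qed.

Definition twin_width : nat := ex_minn contraction_sequence_exists.

End Notions.

(* Main.v *)
Require Import Defs.
From mathcomp Require Import all_boot.
From mathcomp Require Import zify boolp.

Set Implicit Arguments.
Unset Strict Implicit.
Unset Printing Implicit Defensive.

(* Starting from singletons, join consecutive intervals as long as the new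
   interval [A] is poor: outside of at most [d] intervals, the points have at most
   [n] types over [A]. As long as all intervals are poor, each of them has at most
   [d] partners that are not tame, i.e. with more than [K = |Phi| ^ n] types of one
   over the other: if [B] has at most [n] types over [A], then [A] has at most [K]
   types over [B]. Grouping the points of each interval by their types over its tame
   partners gives boundedly many classes, and classes of intervals that are tame to
   each other are homogeneous; these groupings coarsen along the process, which
   yields a contraction sequence.
   If no two consecutive intervals can be joined, then the intervals obtained by
   pairing them up are all rich, i.e. not poor, except perhaps the last one. For a
   rich [A], either there are many intervals [B] for which [A] and [B] have more
   than [k] types over one another, or many intervals [B] that contain a point whose
   type over [A] is fresh, i.e. does not occur to the left of [B]. A Marcus-Tardos
   argument then gives a [t] times [t] division all of whose cells contain either a
   pair of the first kind or many fresh points in distinct intervals [B]; the latter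
   have distinct types over the row range, so in both cases the cell has more
   than [k] types, contradicting simplicity. *)

(** * A grid theorem for dense matrices *)

(** On [A], [g] factors through [h]; most comparisons of numbers of types below reduce to this. *)
Lemma leq_card_imset_factor (T U V : finType) (A : {set T})
    (g : T -> U) (h : T -> V) :
  (forall x y, x \in A -> y \in A -> h x = h y -> g x = g y) ->
  #|g @: A| <= #|h @: A|.
Proof.
move=> gh; have [->|[x0 x0A]] := set_0Vmem A; first by rewrite !imset0 !cards0.
pose r v := odflt x0 [pick x in A | h x == v].
have rP x : x \in A -> r (h x) \in A /\ h (r (h x)) = h x.
  move=> xA; rewrite /r; case: pickP => [y /andP[yA /eqP] //|/(_ x)].
  by rewrite xA eqxx.
suff -> : g @: A = (g \o r) @: (h @: A) by apply: leq_imset_card.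
apply/setP => u; apply/imsetP/imsetP => [[x xA ->]|[v /imsetP[x xA ->] ->]].
  by exists (h x); [apply: imset_f | have [rA rE] := rP _ xA; apply: gh].
by exists (r (h x)) => //; have [] := rP _ xA.
Qed.

Lemma leq_card_imsetU (T U : finType) (g : T -> U) (A B : {set T}) :
  #|g @: (A :|: B)| <= #|g @: A| + #|g @: B|.
Proof. by rewrite imsetU cardsU leq_subr. Qed.

(** * Ranks in a finite total order *)

Section Rank.

Variables (T : finType) (lt : rel T) (F : {set T}).
Hypotheses (lt_irr : irreflexive lt) (lt_trans : transitive lt).
Hypothesis lt_total :
  forall x y, x \in F -> y \in F -> x != y -> lt x y || lt y x.

Definition rank (x : T) : nat := #|[set y in F | lt y x]|.

Lemma rank_homo x y : lt x y -> rank x <= rank y.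
Proof.
move=> xy; apply: subset_leq_card; apply/subsetP => z; rewrite !inE.
by case/andP => -> zx; apply: lt_trans xy.
Qed.

Lemma rank_lt x y : x \in F -> lt x y -> rank x < rank y.
Proof.
move=> xF xy; apply: proper_card; apply/properP; split.
  apply/subsetP => z; rewrite !inE.
  by case/andP => -> zx; apply: lt_trans xy.
by exists x; rewrite !inE xF ?xy ?lt_irr.
Qed.

Lemma rank_inj : {in F &, injective rank}.
Proof.
move=> x y xF yF e; apply/eqP; apply: contraT => /(lt_total xF yF).
by case/orP => [/(rank_lt xF)|/(rank_lt yF)]; rewrite e ltnn.
Qed.

Lemma rank_card x : x \in F -> rank x < #|F|.
Proof.
move=> xF; apply: proper_card; apply/properP; split.
  by apply/subsetP => z; rewrite inE => /andP[].
by exists x => //; rewrite inE lt_irr andbF.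
Qed.

Lemma rank_onto a : a < #|F| -> exists2 x, x \in F & rank x = a.
Proof.
move=> aF; pose o x := if insub (rank x) is Some i then i else Ordinal aF.
have oE x : x \in F -> nat_of_ord (o x) = rank x.
  by move=> /rank_card xF; rewrite /o insubT.
have oF : o @: F = [set: 'I_#|F|].
  apply/eqP; rewrite eqEcard subsetT cardsT card_ord card_in_imset ?leqnn //.
  by move=> x y xF yF /(congr1 val) /=; rewrite !oE //; apply: rank_inj.
have : Ordinal aF \in o @: F by rewrite oF inE.
by case/imsetP => x xF /(congr1 val) /= ->; exists x; rewrite ?oE.
Qed.

End Rank.

Lemma pigeonhole_class (T : finType) (F : {set T}) (c : T -> bool * bool) :
  exists v, #|F| <= 4 * #|[set x in F | c x == v]|.
Proof.
apply/existsP; apply: contraT; rewrite negb_exists => /forallP lt4.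
have : #|F| = \sum_v #|[set x in F | c x == v]|.
  rewrite -sum1_card (partition_big c predT) //=; apply: eq_bigr => v _.
  by rewrite -sum1_card; apply: eq_bigl => x; rewrite inE.
pose G v := #|[set x in F | c x == v]|.
have -> : \sum_v #|[set x in F | c x == v]|
    = G (true, true) + G (true, false) + (G (false, true) + G (false, false)).
  rewrite (eq_bigr (fun v => G (v.1, v.2))) => [|[] //].
  by rewrite -(pair_bigA _ (fun u v => G (u, v))) /= big_bool !big_bool.
have lt v : 4 * G v < #|F| by rewrite ltnNge; apply: lt4.
move: (lt (true, true)) (lt (true, false)) (lt (false, true)) (lt (false, false)).
by move: (G _) (G _) (G _) (G _) => x1 x2 x3 x4; lia.
Qed.

(* The cut follows the heavier half of the interval: a half left behind that
   still has [q] elements becomes a piece of its own. The route and the positions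
   of these pieces along it take 2 bits per halving, whence the factor [4 ^ h]. *)
Lemma common_cut (n q : nat) (I : finType) (W : I -> {set 'I_n}) (h : nat) :
  0 < q ->
  forall (l lo : nat) (F : {set I}),
  (forall x, x \in F -> 2 ^ l * (h.+1 * q) <= #|W x|) ->
  (forall x j, x \in F -> j \in W x -> lo <= j < lo + 2 ^ h) ->
  exists F' : {set I}, exists cut : nat -> nat,
    [/\ F' \subset F, #|F| <= 4 ^ h * #|F'|,
        {homo cut : i j / i <= j}, forall i, cut i <= l &
        forall x b, x \in F' -> b <= l -> q <= #|[set j in W x | cut j == b]|].
Proof.
move=> q0; elim: h W => [|h IHh] W [|l] lo F WF Wlo.
- exists F, (fun=> 0); split => // [|x b xF]; first by rewrite mul1n.
  rewrite leqn0 => /eqP ->; apply: leq_trans (leq_trans _ (WF x xF)) _.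
    by rewrite mul1n leq_pmull.
  by apply: subset_leq_card; apply/subsetP => j; rewrite inE => ->.
- exists F, (fun=> 0); split => // [|x b xF]; first by rewrite mul1n.
  (* A window of length 1 is too short for [2 ^ l.+1 * q] elements, so no [x] is left. *)
  have : #|W x| <= 1.
    apply/card_le1_eqP => i j /(Wlo _ _ xF) ? /(Wlo _ _ xF) ?.
    by apply/val_inj => /=; lia.
  have := WF _ xF; have := expn_gt0 2 l; rewrite expnS; nia.
- exists F, (fun=> 0); split => // [|x b xF].
    by rewrite -{1}[#|F|]mul1n leq_mul2r expn_gt0 orbT.
  rewrite leqn0 => /eqP ->; apply: leq_trans (leq_trans _ (WF x xF)) _.
    by rewrite mul1n leq_pmull.
  by apply: subset_leq_card; apply/subsetP => j; rewrite inE => ->.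
pose mid := lo + 2 ^ h.
pose Lf x := [set j in W x | j < mid]; pose Rt x := [set j in W x | mid <= j].
have LR x : #|W x| = #|Lf x| + #|Rt x|.
  rewrite -(cardsID [set j : 'I_n | j < mid]); congr (_ + _).
    by apply: eq_card => j; rewrite !inE.
  by apply: eq_card => j; rewrite !inE -leqNgt andbC.
(* Two bits: which half is heavier, and whether the lighter one still has [q] elements. *)
pose c x := (#|Rt x| <= #|Lf x|, q <= minn #|Lf x| #|Rt x|).
have [[hv lt] FF1] := pigeonhole_class F c.
set F1 := [set x in F | c x == (hv, lt)] in FF1.
pose H x := if hv then Lf x else Rt x.
pose lo' := if hv then lo else mid.
have F1F : F1 \subset F by apply/subsetP => x; rewrite inE => /andP[].
have Hlo x j : x \in F1 -> j \in H x -> lo' <= j < lo' + 2 ^ h.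
  move=> /(subsetP F1F) xF; rewrite /H /lo' /mid.
  case: (hv) => /=; rewrite inE => /andP[/(Wlo _ _ xF)]; rewrite expnS /mid; lia.
have HW x : H x \subset W x.
  by rewrite /H; case: (hv); apply/subsetP => j; rewrite inE => /andP[].
have WF1 x : x \in F1 -> 2 ^ l.+1 * (h.+2 * q) <= #|Lf x| + #|Rt x|.
  by move=> xF; rewrite -LR; apply: WF; apply: (subsetP F1F).
have p0 := expn_gt0 2 l.
have cF1 x : x \in F1 ->
    (#|Rt x| <= #|Lf x|) = hv /\ (q <= minn #|Lf x| #|Rt x|) = lt.
  by rewrite inE => /andP[_ /eqP[-> ->]].
(* The lighter half becomes a piece, numbered [l.+1] on the right or [0] on the left. The heavier
   one retains half of the weight, enough for [l] further cuts. *)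
case El: lt in cF1.
  have sz x : x \in F1 -> 2 ^ l * (h.+1 * q) <= #|H x|.
    move=> xF; have := WF1 _ xF; have [+ _] := cF1 _ xF.
    by rewrite /H expnS; case: (hv); nia.
  have [F2 [cut [F21 cF2 hcut cutl hit]]] := IHh H l lo' F1 sz Hlo.
  pose cut' j := if hv then (if j < mid then cut j else l.+1)
                 else (if j < mid then 0 else (cut j).+1).
  exists F2, cut'; split.
  - exact: subset_trans F21 F1F.
  - by rewrite expnS; nia.
  - move=> i j ij; rewrite /cut'; have := hcut _ _ ij; have := cutl i.
    by case: (hv); case: (ltnP i mid); case: (ltnP j mid) => //; lia.
  - by move=> i; rewrite /cut'; have := cutl i; case: (hv); case: ifP => //; lia.
  move=> x b xF2 bl; have xF1 := subsetP F21 _ xF2.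
  have [hvx ltx] := cF1 _ xF1.
  have [light|nlight] := boolP (b == (if hv then l.+1 else 0)).
    apply: (@leq_trans #|if hv then Rt x else Lf x|).
      by move: ltx; rewrite leq_min; case: (hv) => /andP[].
    rewrite (eqP light) /cut'.
    case: (hv); apply: subset_leq_card; apply/subsetP => j; rewrite !inE.
      by case/andP => -> mj; rewrite ltnNge mj eqxx.
    by case/andP => -> ->.
  pose b' := if hv then b else b.-1.
  apply: leq_trans (hit x b' xF2 _) _.
    by move: nlight; rewrite /b'; case: (hv) => /=; lia.
  apply: subset_leq_card; apply/subsetP => j; rewrite /H /cut' /b'.
  case: (hv) nlight => /= nb; rewrite !inE => /andP[/andP[-> jm]].
    by rewrite jm.
  by rewrite ltnNge jm /=; lia.
(* The lighter half has fewer than [q] elements: dropping it only costs the passage from [h.+2] to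
   [h.+1], and all [l.+1] cuts remain to be made. *)
have sz x : x \in F1 -> 2 ^ l.+1 * (h.+1 * q) <= #|H x|.
  move=> xF; have := WF1 _ xF; have [] := cF1 _ xF.
  by rewrite /H expnS; case: (hv); nia.
have [F2 [cut [F21 cF2 hcut cutl hit]]] := IHh H l.+1 lo' F1 sz Hlo.
exists F2, cut; split => //; first exact: subset_trans F21 F1F.
  by rewrite expnS; nia.
move=> x b xF2 bl; apply: leq_trans (hit x b xF2 bl) _.
apply: subset_leq_card; apply/subsetP => j; rewrite !inE.
by case/andP => /(subsetP (HW x)) -> ->.
Qed.

Lemma sum_nat_bool (T : finType) (P : pred T) : \sum_x (P x : nat) = #|P|.
Proof.
rewrite -sum1_card [RHS]big_mkcond /=; apply: eq_bigr => x _.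
by rewrite unfold_in; case: (P x).
Qed.

(* The [t] consecutive ranges of rows and of columns are the fibers of [rho] and
   [gamma]; in every cell at least [q] columns have to be nonempty. *)
Definition has_grid (t q n : nat) (E : rel 'I_n) : Prop :=
  exists rho gamma : nat -> nat,
    [/\ {homo rho : i j / i <= j}, {homo gamma : i j / i <= j},
        forall i, rho i < t, forall j, gamma j < t &
        forall a b, a < t -> b < t ->
          q <= #|[set j : 'I_n | (gamma j == b)
                   && [exists i : 'I_n, (rho i == a) && E i j]]|].

(** * Contraction of a matrix into square blocks *)

Section Blocks.

Variables (n b : nat) (E : rel 'I_n).
Hypothesis b0 : 0 < b.
Let n' := (n %/ b).+1.

Definition block (i : 'I_n) : 'I_n' := inord (i %/ b).

Lemma blockE i : block i = i %/ b :> nat.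
Proof. by rewrite inordK // ltnS leq_div2r // ltnW. Qed.

Definition contraction : rel 'I_n' :=
  fun al be => [exists i, exists j, [&& block i == al, block j == be & E i j]].

Definition block_cols (al be : 'I_n') : {set 'I_n} :=
  [set j | (block j == be) && [exists i, (block i == al) && E i j]].

Definition block_rows (al be : 'I_n') : {set 'I_n} :=
  [set i | (block i == al) && [exists j, (block j == be) && E i j]].

(** A block column that is nonempty in a cell provides a nonempty column there, and distinct block
    columns provide distinct columns. *)
Lemma contraction_grid t q : has_grid t q contraction -> has_grid t q E.
Proof.
move=> [rho [gamma [hr hg rt gt hit]]].
exists (fun i => rho (i %/ b)), (fun j => gamma (j %/ b)); split => //.
- by move=> i j ij; apply/hr/leq_div2r.
- by move=> i j ij; apply/hg/leq_div2r.
move=> a c at' ct; apply: leq_trans (hit a c at' ct) _.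
apply: leq_trans (leq_imset_card block _).
apply: subset_leq_card; apply/subsetP => be; rewrite inE.
case/andP => /eqP gb /existsP[al /andP[/eqP ra]].
case/existsP => i /existsP[j /and3P[/eqP ia /eqP jb Eij]].
apply/imsetP; exists j => //; rewrite inE -blockE jb gb eqxx /=.
by apply/existsP; exists i; rewrite -blockE ia ra eqxx.
Qed.

Lemma block_range h (i : 'I_n) (al : 'I_n') :
  b = 2 ^ h -> block i = al -> al * b <= i < al * b + 2 ^ h.
Proof.
move=> bE /(congr1 val) /=; rewrite blockE => <-.
by rewrite -bE leq_divM /= -mulSnr ltn_ceil.
Qed.

Variables (t q h : nat).
Hypotheses (t0 : 0 < t) (q0 : 0 < q) (bE : b = 2 ^ h).
Let w := 2 ^ t * (h.+1 * q).

Let ltr m (F : {set 'I_m}) (x y : 'I_m) :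
  x \in F -> y \in F -> x != y -> (x < y) || (y < x).
Proof. by move=> _ _; rewrite -neq_ltn. Qed.

Let lt_irr m : irreflexive (fun x y : 'I_m => x < y).
Proof. by move=> x; rewrite ltnn. Qed.

Let lt_trans m : transitive (fun x y : 'I_m => x < y).
Proof. by move=> y x z; apply: ltn_trans. Qed.

Let below (F : {set 'I_n'}) (x : nat) := #|[set y in F | y < x]|.

Let below_homo F : {homo below F : x y / x <= y}.
Proof.
move=> x y xy; apply: subset_leq_card; apply/subsetP => z; rewrite !inE.
by case/andP => -> /leq_trans; apply.
Qed.

Let below_onto (F : {set 'I_n'}) a : a < #|F| ->
  exists2 x, x \in F & below F x = a.
Proof.
exact: (@rank_onto _ (fun x y : 'I_n' => x < y) F (@lt_irr _) (@lt_trans _)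
          (@ltr _ _)).
Qed.

Let wl : 2 ^ t.-1 * (h.+1 * q) <= w.
Proof. by rewrite leq_mul2r leq_exp2l // leq_pred orbT. Qed.

(** The wide blocks of one block column live on the same [b] columns. By [common_cut], at least [t]
    of them share a cut that leaves each of them [q] columns in every range; a row range then only
    has to contain one of them. *)
Lemma wide_grid (be : 'I_n') :
  t * 4 ^ h <= #|[set al | w <= #|block_cols al be|]| -> has_grid t q E.
Proof.
set F := [set al | _] => tF.
have FP al : al \in F -> 2 ^ t.-1 * (h.+1 * q) <= #|block_cols al be|.
  by rewrite inE; apply: leq_trans.
have Flo al j : al \in F -> j \in block_cols al be ->
    be * b <= j < be * b + 2 ^ h.
  by move=> _; rewrite inE => /andP[/eqP /(block_range bE)].
have [F' [cut [F'F cF hcut cutt hit]]] :=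
  common_cut q0 FP Flo.
have tF' : t <= #|F'|.
  by rewrite -(leq_pmul2l (expn_gt0 4 h)) mulnC; apply: leq_trans cF.
(* Everything of rank at least [t.-1] goes to the last range. *)
exists (fun i => minn t.-1 (below F' (i %/ b))), cut; split => //.
- move=> i j ij; rewrite leq_min geq_minl /=; apply: leq_trans (geq_minr _ _) _.
  exact/below_homo/leq_div2r.
- by move=> i; rewrite -[ltnRHS](prednK t0) ltnS geq_minl.
- by move=> j; rewrite -[ltnRHS](prednK t0) ltnS.
move=> a c at' ct.
have [al alF' ala] := below_onto (leq_trans at' tF').
have := hit al c alF'; rewrite -ltnS (prednK t0) => /(_ ct) /leq_trans; apply.
apply: subset_leq_card; apply/subsetP => j; rewrite !inE.
case/andP => /andP[_ /existsP[i /andP[/eqP ia Eij]]] -> /=.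
by apply/existsP; exists i; rewrite Eij andbT -blockE ia ala; apply/eqP; lia.
Qed.

(* The columns being cut by counting blocks, [t * q] blocks are needed to have
   [q] of them in each of the [t] ranges. *)
Lemma tall_grid (al : 'I_n') :
  t * q * 4 ^ h <= #|[set be | w <= #|block_rows al be|]| -> has_grid t q E.
Proof.
set F := [set be | _] => tF.
have FP be : be \in F -> 2 ^ t.-1 * (h.+1 * q) <= #|block_rows al be|.
  by rewrite inE; apply: leq_trans.
have Flo be i : be \in F -> i \in block_rows al be ->
    al * b <= i < al * b + 2 ^ h.
  by move=> _; rewrite inE => /andP[/eqP /(block_range bE)].
have [F' [cut [F'F cF hcut cutt hit]]] :=
  common_cut q0 FP Flo.
have tF' : t * q <= #|F'|.
  by rewrite -(leq_pmul2l (expn_gt0 4 h)) mulnC; apply: leq_trans cF.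
exists cut, (fun j => minn t.-1 (below F' (j %/ b) %/ q)); split => //.
- move=> i j ij; rewrite leq_min geq_minl /=; apply: leq_trans (geq_minr _ _) _.
  by apply/leq_div2r/below_homo/leq_div2r.
- by move=> i; rewrite -[ltnRHS](prednK t0) ltnS.
- by move=> j; rewrite -[ltnRHS](prednK t0) ltnS geq_minl.
move=> a c at' ct.
set J := [set j | _].
pose pos (j : 'I_n) := below F' (j %/ b).
(* The [u]-th column for range [c] is taken in the block of rank [c * q + u] in [F'], which makes
   these columns distinct. *)
pose P (u : 'I_q) (j : 'I_n) := (j \in J) && (pos j == c * q + u).
have ex u : exists j, P u j.
  have : c * q + u < #|F'|.
    by apply: leq_trans tF'; have := ltn_ord u; nia.
  case/below_onto => be beF' bee.
  have := hit be a beF'; rewrite -ltnS (prednK t0) => /(_ at').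
  move/(leq_trans q0); rewrite card_gt0 => /set0Pn[i]; rewrite !inE.
  case/andP => /andP[/eqP ia /existsP[j /andP[/eqP jb Eij]]] ra.
  exists j; rewrite /P /pos !inE -blockE jb bee eqxx andbT.
  rewrite divnMDl // (divn_small (ltn_ord u)) addn0.
  apply/andP; split; first by apply/eqP; lia.
  by apply/existsP; exists i; rewrite ra.
pose jj u := xchoose (ex u).
rewrite -[leqLHS]card_ord -cardsT.
have jinj : injective jj.
  move=> u v e; apply/val_inj/eqP; rewrite -(eqn_add2l (c * q)).
  have /andP[_ /eqP <-] := xchooseP (ex u).
  by have /andP[_ /eqP <-] := xchooseP (ex v); rewrite -/(jj u) e.
rewrite -(card_imset _ jinj); apply: subset_leq_card.
apply/subsetP => j /imsetP[u _ ->].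
by have /andP[] := xchooseP (ex u).
Qed.

Let points al be := [set p : 'I_n * 'I_n
  | [&& block p.1 == al, block p.2 == be & E p.1 p.2]].

Lemma points_le al be :
  #|points al be| <= #|block_rows al be| * #|block_cols al be|.
Proof.
rewrite -cardsX; apply: subset_leq_card; apply/subsetP => -[i j].
rewrite !inE /= => /and3P[ia jb Eij]; rewrite ia jb /=.
by apply/andP; split; apply/existsP; [exists j; rewrite jb | exists i; rewrite ia].
Qed.

Let range_le (al : 'I_n') (F : {set 'I_n}) :
  (forall i, i \in F -> block i = al) -> #|F| <= b.
Proof.
move=> Fal; pose r (i : 'I_n) : 'I_b := Ordinal (ltn_pmod i b0).
rewrite -[leqRHS]card_ord -cardsT -(@card_in_imset _ _ r F); last first.
  move=> i j /Fal ia /Fal ja /(congr1 val) /= e; apply/val_inj => /=.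
  by rewrite (divn_eq i b) (divn_eq j b) -!blockE ia ja e.
exact/subset_leq_card/subsetT.
Qed.

Lemma points_block al be : #|points al be| <= b * b.
Proof.
apply: leq_trans (points_le al be) _; apply: leq_mul.
  by apply: (@range_le al) => i; rewrite inE => /andP[/eqP].
by apply: (@range_le be) => i; rewrite inE => /andP[/eqP].
Qed.

(** A block with fewer than [w] nonempty rows and columns has at most [w ^ 2] points, and none if it
    vanishes in the contraction; a wide or tall block is charged in full. *)
Lemma points_bound al be :
  #|points al be| <= contraction al be * w ^ 2
    + ((w <= #|block_cols al be|) + (w <= #|block_rows al be|)) * b ^ 2.
Proof.
case: (leqP w #|block_cols al be|) => hc.
  apply: leq_trans (points_block al be) _.
  by rewrite mulnDl mul1n mulnn addnCA leq_addr.
case: (leqP w #|block_rows al be|) => hr.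
  by apply: leq_trans (points_block al be) _; rewrite mul1n mulnn leq_addl.
rewrite addn0; have [->|[[i j]]] := set_0Vmem (points al be).
  by rewrite cards0.
rewrite inE /= => /and3P[ia jb Eij].
have -> : contraction al be.
  by apply/existsP; exists i; apply/existsP; exists j; rewrite ia jb.
rewrite mul1n -mulnn; apply: leq_trans (points_le al be) _.
by apply: leq_mul; apply: ltnW.
Qed.

Lemma card_points :
  #|[set p : 'I_n * 'I_n | E p.1 p.2]| = \sum_al \sum_be #|points al be|.
Proof.
rewrite pair_bigA /= -sum1_card.
rewrite (partition_big (fun p => (block p.1, block p.2)) predT) //=.
apply: eq_bigr => -[al be] _; rewrite -sum1_card; apply: eq_bigl => -[i j].
by rewrite !inE xpair_eqE /=; case: (E i j); rewrite ?andbT ?andbF.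
Qed.

(** Sum [points_bound]: without a grid, every block column has fewer than [t * 4 ^ h] wide blocks
    and every block row fewer than [t * q * 4 ^ h] tall ones. *)
Lemma points_step :
  #|[set p | E p.1 p.2]| <= #|[set p | contraction p.1 p.2]| * w ^ 2
     + n' * (t * 4 ^ h + t * q * 4 ^ h) * b ^ 2
  \/ has_grid t q E.
Proof.
have [/existsP[be /wide_grid]|nwide] := boolP [exists be : 'I_n',
  t * 4 ^ h <= #|[set al | w <= #|block_cols al be|]|]; first by right.
have [/existsP[al /tall_grid]|ntall] := boolP [exists al : 'I_n',
  t * q * 4 ^ h <= #|[set be | w <= #|block_rows al be|]|]; first by right.
left; rewrite card_points.
apply: (@leq_trans (\sum_al \sum_be (contraction al be * w ^ 2
    + ((w <= #|block_cols al be|) + (w <= #|block_rows al be|)) * b ^ 2))).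
  by apply: leq_sum => al _; apply: leq_sum => be _; apply: points_bound.
under eq_bigr => al _ do rewrite big_split /= -!big_distrl big_split /=.
rewrite big_split /= -!big_distrl big_split /= leq_add //.
  rewrite leq_mul2r; apply/orP; right.
  rewrite pair_bigA /= sum_nat_bool; apply: subset_leq_card.
  by apply/subsetP => p; rewrite inE.
rewrite leq_mul2r; apply/orP; right; rewrite mulnDr leq_add //.
  rewrite exchange_big /= -[n' in leqRHS]card_ord -sum_nat_const.
  apply: leq_sum => be _; apply: ltnW; move: nwide; rewrite negb_exists.
  by move/forallP/(_ be); rewrite -ltnNge sum_nat_bool cardsE.
rewrite -[n' in leqRHS]card_ord -sum_nat_const.
apply: leq_sum => al _; apply: ltnW; move: ntall; rewrite negb_exists.
by move/forallP/(_ al); rewrite -ltnNge sum_nat_bool cardsE.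
Qed.

End Blocks.

(** As [8 ^ h = 4 ^ h * b] for [b = 2 ^ h], this is [4 * b] times the coefficient of [n' * b ^ 2] in
    [points_step]. *)
Definition grid_density (t q h : nat) := 4 * (t * q.+1) * 8 ^ h.

(* Marcus-Tardos block recursion; a density single exponential in [t], as in Fox's
   improvement, is what makes the final bound doubly exponential in [k * t]. *)
Theorem dense_grid (t q h n : nat) (E : rel 'I_n) :
  0 < t -> 0 < q -> 4 * (2 ^ t * (h.+1 * q)) ^ 2 <= 2 ^ h ->
  grid_density t q h * n < #|[set p | E p.1 p.2]| -> has_grid t q E.
Proof.
move=> t0 q0 hw; have [N] := ubnP n; elim: N n E => // N IHN n E.
rewrite ltnS => nN dE; set C := grid_density t q h in IHN dE *.
pose b := 2 ^ h; have b0 : 0 < b by rewrite expn_gt0.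
have b8 : 8 ^ h = 4 ^ h * b by rewrite -expnMn.
have tq0 : 0 < t * q.+1 by rewrite muln_gt0 t0.
have h40 : 0 < 4 ^ h by rewrite expn_gt0.
have [nb|bn] := leqP n b.
  have : #|[set p : 'I_n * 'I_n | E p.1 p.2]| <= n * n.
    by rewrite -[leqRHS](_ : #|{: 'I_n * 'I_n}| = _) ?max_card // card_prod card_ord.
  have bC : b <= C by rewrite /C /grid_density b8 mulnA leq_pmull //
      !muln_gt0 t0 h40.
  move=> le_nn; move: dE; rewrite ltnNge (leq_trans le_nn) //.
  by rewrite leq_mul2r (leq_trans nb bC) orbT.
have [step|//] := points_step E b0 t0 q0 (erefl b).
set n' := (n %/ b).+1 in step; set dE' := #|[set p | contraction _ _ _]| in step.
have n'n : b * n' <= 2 * n.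
  rewrite /n' mulnS mulnC mul2n -addnn.
  by apply: leq_add; [apply: ltnW | apply: leq_divM].
have b2 : 4 <= b.
  by apply: leq_trans hw; rewrite leq_pmulr // expn_gt0 !muln_gt0 expn_gt0 q0.
have [dE'C|] := ltnP (C * n') dE'.
  by apply: (@contraction_grid _ b) => //; apply: IHN dE'C; nia.
move=> dE'C; suff : 2 * b * #|[set p | E p.1 p.2]| <= 2 * b * (C * n).
  by rewrite leq_pmul2l ?muln_gt0 // leqNgt dE.
apply: leq_trans (leq_mul (leqnn _) step) _.
have CE : C = 4 * (t * 4 ^ h + t * q * 4 ^ h) * b.
  by rewrite /C /grid_density b8; lia.
move: CE hw n'n dE'C; rewrite -/b; move: ((2 ^ t * (h.+1 * q)) ^ 2) => w2.
clear dE IHN step.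
move: (t * 4 ^ h + _) n' C dE' => u m c d cE hw mn dc.
(* Each of the two terms takes at most half of [c * n]: [h1] by [4 * w2 <= b], [h2] by the value of
   [c], both with [b * m <= 2 * n]. *)
have h1 : 2 * b * (d * w2) <= b * (c * n).
  apply: (@leq_trans (2 * b * (c * m * w2))); first by rewrite !leq_mul.
  have : b * m * (2 * c * w2) <= 2 * n * (2 * c * w2) by rewrite leq_mul.
  have : 4 * w2 * (c * n) <= b * (c * n) by rewrite leq_mul.
  lia.
have h2 : 2 * b * (m * u * b ^ 2) <= b * (c * n).
  have : b * m * (2 * u * b ^ 2) <= 2 * n * (2 * u * b ^ 2) by rewrite leq_mul.
  rewrite cE; lia.
lia.
Qed.

(** * Bounding the red degree of a sequence of convex partitions *)

Section Refinement.

Variables (Sigma : ordSignature) (S : ordStructure Sigma).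
Implicit Types P Q : {set {set S}}.

Definition refines Q P : Prop :=
  forall B, B \in Q -> exists2 A, A \in P & B \subset A.

Lemma partition_nonempty P B :
  partition P [set: S] -> B \in P -> exists x, x \in B.
Proof.
case/and3P => _ _ P0 BP; apply/set0Pn.
by apply: contraNneq P0 => <-.
Qed.

Lemma partition_eq P A B (x : S) :
  partition P [set: S] -> A \in P -> B \in P -> x \in A -> x \in B -> A = B.
Proof.
case/and3P => _ trP _ AP BP xA xB.
by rewrite -(def_pblock trP AP xA) -(def_pblock trP BP xB).
Qed.

Lemma refines_refl P : refines P P.
Proof. by move=> B BP; exists B. Qed.

Lemma subset_partition_eq P Q :
  partition P [set: S] -> partition Q [set: S] -> Q \subset P -> P = Q.
Proof.
move=> pP pQ /subsetP QP; apply/setP => A; apply/idP/idP; last exact: QP.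
move=> AP; have [x xA] := partition_nonempty pP AP.
have : x \in cover Q by have /and3P[/eqP -> _ _] := pQ; rewrite inE.
by case/bigcupP => B BQ xB; rewrite (partition_eq pP AP (QP _ BQ) xA xB).
Qed.

(** Induction on the number of parts of [Q] missing from [P]: each step cuts one of them off the
    part of [P] that contains it. *)
Lemma splitting_path P Q :
  partition P [set: S] -> partition Q [set: S] -> refines Q P ->
  exists s, [/\ path (@splits _ S) P s, last P s = Q &
    forall R, R \in s ->
      [/\ partition R [set: S], refines R P & refines Q R]].
Proof.
move=> pP pQ; have [n] := ubnP #|Q :\: P|.
elim: n P pP => // n IHn P pP; rewrite ltnS => lePn QP.
have [QsP|/subsetPn[B BQ BP]] := boolP (Q \subset P).
  by exists [::]; rewrite /= (subset_partition_eq pP pQ QsP).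
have [A AP BA] := QP B BQ.
pose R := B |: ((A :\: B) |: (P :\ A)).
have PR : splits P R.
  apply/existsP; exists A; rewrite AP; apply/existsP; exists B.
  rewrite eqxx andbT properEneq BA andbT.
  have [x xB] := partition_nonempty pQ BQ.
  apply/andP; split; first by apply/set0Pn; exists x.
  by apply: contraNneq BP => ->.
have pR := splits_partition pP PR.
have RP : refines R P.
  move=> C; rewrite !inE => /or3P[/eqP->|/eqP->|/andP[_ CP]].
  - by exists A.
  - by exists A => //; apply: subsetDl.
  - by exists C.
have QR : refines Q R.
  move=> C CQ; have [->|CB] := eqVneq C B; first by exists B; rewrite // !inE eqxx.
  have [C' C'P CC'] := QP C CQ.
  have [eA|neA] := eqVneq C' A; last by exists C'; rewrite // !inE neA C'P !orbT.
  exists (A :\: B); first by rewrite !inE eqxx orbT.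
  rewrite -eA; apply/subsetP => x xC; rewrite inE (subsetP CC' _ xC) andbT.
  by apply: contra CB => xB; rewrite (partition_eq pQ CQ BQ xC xB).
have lt : #|Q :\: R| < n.
  apply: leq_trans lePn; apply: proper_card; apply/properP; split.
    apply/subsetP => C; rewrite !inE !negb_or => /andP[/and3P[CB CAB]].
    have [eA|_] := eqVneq C A => /= [_|->] // CQ; case/eqP: CB.
    have [x xB] := partition_nonempty pQ BQ.
    by apply: (partition_eq pQ CQ BQ _ xB); rewrite eA (subsetP BA).
  by exists B; rewrite !inE ?eqxx ?BP.
have [s [ps ls als]] := IHn R pR lt QR.
exists (R :: s); split => //=; first by rewrite PR.
move=> R'; rewrite inE => /orP[/eqP -> //|/als[pR' R'R QR']]; split => //.
by move=> C /R'R[C' /RP[C'' C''P s2] s1]; exists C'' => //; apply: subset_trans s2.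
Qed.

End Refinement.

(** * Counting types over a set *)

Section Traces.

Variables (Sigma : ordSignature) (S : ordStructure Sigma).
Implicit Types (A B : {set S}) (x y : S).

Local Notation Phi := {ffun binary_symbol Sigma -> bool * bool}.

Definition atomic_type x y : Phi :=
  [ffun R => (binary_rel R x y, binary_rel R y x)].

Lemma atomic_type_sym x y x' y' :
  atomic_type x y = atomic_type x' y' -> atomic_type y x = atomic_type y' x'.
Proof.
by move/ffunP => e; apply/ffunP => R; have := e R; rewrite !ffunE => -[-> ->].
Qed.

Lemma homogeneousI A B :
  (forall x x' y y', x \in A -> x' \in A -> y \in B -> y' \in B ->
     atomic_type x y = atomic_type x' y') -> homogeneous A B.
Proof.
move=> AB; apply/forallP => R.
apply/forallP => x; apply/implyP => xA; apply/forallP => x'; apply/implyP => x'A.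
apply/forallP => y; apply/implyP => yB; apply/forallP => y'; apply/implyP => y'B.
have /ffunP/(_ R) := AB x x' y y' xA x'A yB y'B.
by rewrite !ffunE => -[-> ->]; rewrite !eqxx.
Qed.

(* Unlike [tp], a trace over [B] records all the symbols at once, in both
   directions. *)
Definition trace B x : {ffun S -> option Phi} :=
  [ffun y => if y \in B then Some (atomic_type x y) else None].

Lemma traceP B x x' :
  trace B x = trace B x' <->
  (forall y, y \in B -> atomic_type x y = atomic_type x' y).
Proof.
split=> [/ffunP e y yB|e]; first by have := e y; rewrite !ffunE yB => -[].
by apply/ffunP => y; rewrite !ffunE; case: ifP => // /e ->.
Qed.

Definition ntraces A B : nat := #|trace B @: A|.

Lemma ntracesS A A' B B' :
  A \subset A' -> B \subset B' -> ntraces A B <= ntraces A' B'.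
Proof.
move=> sA sB; apply: (@leq_trans #|trace B' @: A|).
  apply: leq_card_imset_factor => x y _ _ /traceP e; apply/traceP => z zB.
  by apply: e; apply: (subsetP sB).
exact/subset_leq_card/imsetS.
Qed.

Lemma ntracesU A B B' : ntraces A (B :|: B') <= ntraces A B * ntraces A B'.
Proof.
rewrite /ntraces -cardsX.
apply: leq_trans
  (@leq_card_imset_factor _ _ _ A _ (fun x => (trace B x, trace B' x)) _) _.
  move=> x y _ _ [/traceP e /traceP e']; apply/traceP => z; rewrite inE.
  by case/orP => [/e|/e'].
apply: subset_leq_card; apply/subsetP => _ /imsetP[x xA ->].
by rewrite inE /= !imset_f.
Qed.

Lemma ntraces0r A : ntraces A set0 <= 1.
Proof.
apply/card_le1_eqP => _ _ /imsetP[x _ ->] /imsetP[y _ ->].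
by apply/traceP => z; rewrite inE.
Qed.

(** How [x] in [A] relates to [y] depends only on the trace of [y] over [A], so the trace of [x]
    over [B] amounts to a function from the traces of [B] over [A] to atomic types. *)
Lemma ntraces_dual A B : ntraces A B <= #|{: Phi}| ^ ntraces B A.
Proof.
pose T := trace A @: B.
pose h x : {ffun 'I_#|T| -> Phi} :=
  [ffun i => odflt (atomic_type x x) ((enum_val i : {ffun S -> option Phi}) x)].
apply: (@leq_trans #|h @: A|).
  apply: leq_card_imset_factor => x x' xA x'A /ffunP e; apply/traceP => y yB.
  apply: atomic_type_sym.
  have yT : trace A y \in T by apply: imset_f.
  have := e (enum_rank_in yT (trace A y)).
  by rewrite !ffunE !enum_rankK_in // !ffunE xA x'A.
by apply: leq_trans (max_card _) _; rewrite card_ffun card_ord.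
Qed.

End Traces.

(** * Classes of points with equal types over tame parts *)

Section Stages.

Variables (Sigma : ordSignature) (S : ordStructure Sigma).
Implicit Types (A B : {set S}) (x y : S) (f g : S -> nat) (Y : seq nat).

Local Notation Phi := {ffun binary_symbol Sigma -> bool * bool}.

(* A partition of the carrier is given by a numbering of its parts. *)
Definition part f (i : nat) : {set S} := [set x | f x == i].

Definition outside f Y : {set S} := [set x | f x \notin Y].

Definition poor_set d n f A : Prop :=
  exists2 Y, size Y <= d & ntraces (outside f Y) A <= n.

Definition poor d n f : Prop := forall x, poor_set d n f (part f (f x)).

Variables (d n : nat).
Hypothesis n0 : 0 < n.

Let K := #|{: Phi}| ^ n.

Let Phi2 : 1 < #|{: Phi}|.
Proof.
rewrite card_ffun card_prod card_bool; apply: (@leq_ltn_trans (4 ^ 0)) => //.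
by rewrite ltn_exp2l //; apply/card_gt0P; exists (order_symbol Sigma).
Qed.

Let nK : n <= K.
Proof. exact/ltnW/ltn_expl. Qed.

Let K0 : 0 < K.
Proof. exact: leq_trans nK. Qed.

(* Pairs that are not tame may be red, so points are grouped by their types over
   the tame parts only. As tameness can only be lost when parts are joined, this
   equivalence gets coarser. *)
Definition tame f i j : bool :=
  [&& i != j, ntraces (part f i) (part f j) <= K
    & ntraces (part f j) (part f i) <= K].

Definition tame_set f i : {set S} := [set y | tame f i (f y)].

(** The part enters as a set rather than as a number to give keys a finite type, as counting images
    requires. *)
Definition key f x := (part f (f x), trace (tame_set f (f x)) x).

Lemma tame_sym f i j : tame f i j = tame f j i.
Proof. by rewrite /tame eq_sym [X in _ && X]andbC. Qed.

Lemma keyP f x y :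
  key f x = key f y <->
  f x = f y /\ (forall z, tame f (f x) (f z) ->
                  atomic_type x z = atomic_type y z).
Proof.
split=> [[/setP/(_ x) e]|[e t]].
  have exy : f x = f y by move: e; rewrite !inE eqxx => /esym/eqP.
  rewrite exy => /traceP t; split=> // z tz.
  by apply: t; rewrite inE.
by rewrite /key e; congr pair; apply/traceP => z; rewrite inE -e => /t.
Qed.

Lemma key_coarsen f g x y :
  (forall x y, f x = f y -> g x = g y) -> key f x = key f y -> key g x = key g y.
Proof.
move=> fg /keyP[e t]; apply/keyP; split; first exact: fg.
move=> z tz; apply: t; move: tz; rewrite /tame.
have sub u : part f (f u) \subset part g (g u).
  by apply/subsetP => v; rewrite !inE => /eqP/fg ->.
case/and3P => nxz c1 c2; apply/and3P; split.
- by apply: contraNneq nxz => /fg ->.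
- by apply: leq_trans c1; apply: ntracesS.
- by apply: leq_trans c2; apply: ntracesS.
Qed.

Definition classes f := preim_partition (key f) [set: S].

Lemma classes_partition f : partition (classes f) [set: S].
Proof. exact: preim_partitionP. Qed.

Lemma classesP f B :
  reflect (exists x, B = [set y | key f x == key f y]) (B \in classes f).
Proof.
apply: (iffP imsetP) => [[x _ ->]|[x ->]]; exists x; rewrite ?inE //.
  by apply/setP => y; rewrite !inE.
by apply/setP => y; rewrite !inE.
Qed.

Lemma classes_refines f g :
  (forall x y, f x = f y -> g x = g y) -> refines (classes f) (classes g).
Proof.
move=> fg _ /classesP[x ->]; exists [set y | key g x == key g y].
  by apply/classesP; exists x.
apply/subsetP => y; rewrite !inE => /eqP/(key_coarsen fg) ->.
by rewrite eqxx.
Qed.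

(** The types of part [j] over part [i] are among the at most [n] types from outside [Y];
    [ntraces_dual] gives [K] for the converse direction. *)
Lemma poor_tame f Y i j :
  ntraces (outside f Y) (part f i) <= n -> i != j -> j \notin Y -> tame f i j.
Proof.
move=> YP ij jY; rewrite /tame ij /=.
have nji : ntraces (part f j) (part f i) <= n.
  apply: leq_trans YP; apply: ntracesS => //.
  by apply/subsetP => y; rewrite !inE => /eqP ->.
rewrite (leq_trans nji nK) andbT.
by apply: leq_trans (ntraces_dual _ _) _; rewrite leq_exp2l.
Qed.

(** Tame partners lie outside [Y] or among at most [d] parts. The former give a factor [K] by
    duality; each of the latter gives a factor [K] by tameness, or has no points in the tame set. *)
Lemma card_key_part f i :
  poor_set d n f (part f i) -> #|key f @: part f i| <= K * K ^ d.
Proof.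
case=> Y Yd YP.
apply: (@leq_trans (ntraces (part f i) (tame_set f i))).
  apply: leq_card_imset_factor => x y; rewrite !inE => /eqP xi /eqP yi.
  by rewrite /key xi yi => ->.
pose T (Z : seq nat) := [set y in tame_set f i | f y \in Z].
apply: (@leq_trans (ntraces (part f i) (outside f Y :|: T Y))).
  apply: ntracesS => //; apply/subsetP => y yt; rewrite !inE in yt *.
  by rewrite yt; case: (_ \in Y).
apply: leq_trans (ntracesU _ _ _) _; apply: leq_mul.
  by apply: leq_trans (ntraces_dual _ _) _; rewrite leq_exp2l.
apply: leq_trans (_ : _ <= K ^ size Y) _; last by rewrite leq_pexp2l.
elim: {Yd YP} Y => [|j Y IHY].
  apply: leq_trans (ntraces0r (part f i)); apply: ntracesS => //.
  by apply/subsetP => y; rewrite !inE andbF.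
apply: (@leq_trans (ntraces (part f i) (T [:: j] :|: T Y))).
  apply: ntracesS => //; apply/subsetP => y; rewrite !inE.
  by case/andP => -> ->.
apply: leq_trans (ntracesU _ _ _) _; rewrite expnS; apply: leq_mul => //.
have [tj|ntj] := boolP (tame f i j).
  have /and3P[_ c _] := tj; apply: leq_trans c; apply: ntracesS => //.
  by apply/subsetP => y; rewrite !inE => /andP[_].
apply: leq_trans K0; apply: leq_trans (ntraces0r (part f i)).
apply: ntracesS => //; apply/subsetP => y; rewrite !inE => /andP[t /eqP fy].
by rewrite fy (negbTE ntj) in t.
Qed.

(** [d.+1] counts the part itself and its exceptional partners, [2] the finer parts that each may be
    joined from, [K * K ^ d] the classes of a finer part. *)
Definition red_bound := d.+1 * (2 * (K * K ^ d)).

(** Members of [P] in tame parts of [g] are homogeneous, as [P] refines the classes of [g]. So the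
    red partners lie in at most [d.+1] parts of [g]; each contains a class of [f], and it suffices
    to count keys of [f]. *)
Lemma red_degree_between f g (P : {set {set S}}) :
  poor d n f -> poor d n g ->
  (forall j, exists a b, part g j \subset part f a :|: part f b) ->
  partition P [set: S] -> refines P (classes g) -> refines (classes f) P ->
  partition_red_degree P <= red_bound.
Proof.
move=> pf pg fg pP Pg fP; apply/bigmax_leqP => X XP.
have [x0 x0X] := partition_nonempty pP XP.
have keyX A x y : A \in P -> x \in A -> y \in A -> key g x = key g y.
  move=> AP xA yA; have [_ /classesP[z ->] /subsetP AC] := Pg _ AP.
  by have := (AC _ xA, AC _ yA); rewrite !inE => -[/eqP <- /eqP <-].
have cover_card i : #|key f @: part f i| <= K * K ^ d.
  have [->|[x]] := set_0Vmem (part f i); first by rewrite imset0 cards0.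
  by rewrite inE => /eqP <-; apply: card_key_part.
have [Y Yd YP] := pg x0.
pose Z (Y : seq nat) : {set S} := [set y | g y \in Y].
pose W := g x0 :: Y.
apply: (@leq_trans #|pblock P @: Z W|).
  apply: subset_leq_card; apply/subsetP => B; rewrite !inE.
  case/and3P => BP BX nh; have [y0 y0B] := partition_nonempty pP BP.
  apply/imsetP; exists y0; last first.
    by have /and3P[_ trP _] := pP; rewrite (def_pblock trP BP y0B).
  rewrite !inE; apply: contraNT nh; rewrite negb_or => /andP[ny0 y0Y].
  have tm : tame g (g x0) (g y0) by rewrite (poor_tame YP) // eq_sym.
  apply: homogeneousI => x x' y y' xX x'X yB y'B.
  have /keyP[ex tx] := keyX _ _ _ XP xX x'X.
  have /keyP[ey ty] := keyX _ _ _ BP yB y'B.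
  have /keyP[ex0 _] := keyX _ _ _ XP xX x0X.
  have /keyP[ey0 _] := keyX _ _ _ BP yB y0B.
  rewrite tx ?ex0 ?ey0 //; apply: atomic_type_sym; apply: ty.
  by rewrite -ex ex0 ey0 tame_sym.
apply: (@leq_trans #|key f @: Z W|).
  apply: leq_card_imset_factor => x y _ _ e.
  have /fP[C CP /subsetP sC] : [set z | key f x == key f z] \in classes f.
    by apply/classesP; exists x.
  have /and3P[_ trP _] := pP.
  by rewrite (def_pblock trP CP (sC x _)) ?(def_pblock trP CP (sC y _)) // !inE ?e.
have : size W <= d.+1 by [].
rewrite /red_bound -(leq_pmul2r (_ : 0 < 2 * (K * K ^ d))); last first.
  by rewrite !muln_gt0 K0 expn_gt0 K0.
apply: leq_trans; elim: W => [|j W IHW].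
  by rewrite (_ : Z [::] = set0 :> {set S}) ?imset0 ?cards0.
rewrite [size _]/= mulSn; have [a [b sab]] := fg j.
apply: (@leq_trans #|key f @: ((part f a :|: part f b) :|: Z W)|).
  apply/subset_leq_card/imsetS/subsetP => y; rewrite !inE.
  by case/orP => [gj|->]; rewrite ?orbT //; have := subsetP sab y; rewrite !inE => ->.
apply: leq_trans (leq_card_imsetU _ _ _) _; apply: leq_add => //.
apply: leq_trans (leq_card_imsetU _ _ _) _; rewrite mul2n -addnn.
by apply: leq_add.
Qed.

End Stages.

(** * Contraction sequences from joining intervals *)

Section Merging.

Variables (Sigma : ordSignature) (S : ordStructure Sigma).
Implicit Types (x y : S) (f g : S -> nat) (A B : {set S}).

Local Notation Phi := {ffun binary_symbol Sigma -> bool * bool}.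

Record convex_numbering f m : Prop := ConvexNumbering {
  numbering_lt : forall x, f x < m;
  numbering_onto : forall i, i < m -> exists x, f x = i;
  numbering_homo : forall x y, ord_le x y -> f x <= f y
}.

(** The comparison is read as 0 or 1: labels above [i] drop by one, which merges [i] and [i.+1]. *)
Definition join_parts i f x := f x - (i < f x).

Lemma join_parts_factor i f x y : f x = f y -> join_parts i f x = join_parts i f y.
Proof. by rewrite /join_parts => ->. Qed.

Lemma join_parts_numbering i f m :
  i.+1 < m -> convex_numbering f m -> convex_numbering (join_parts i f) m.-1.
Proof.
move=> im [fm fo fh]; split=> [x|j jm|x y /fh]; last by rewrite /join_parts; lia.
  by have := fm x; rewrite /join_parts; lia.
have [ji|ij] := leqP j i.
  have [|x fx] := fo j; first by lia.
  by exists x; rewrite /join_parts fx; lia.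
have [|x fx] := fo j.+1; first by lia.
by exists x; rewrite /join_parts fx; lia.
Qed.

Lemma join_parts_sub i f j :
  exists a b, part (join_parts i f) j \subset part f a :|: part f b.
Proof.
by exists j, j.+1; apply/subsetP => x; rewrite !inE /join_parts; lia.
Qed.

Lemma poor_setS d n f g A B (h : nat -> nat) :
  (forall x, g x = h (f x)) -> B \subset A -> poor_set d n f A ->
  poor_set d n g B.
Proof.
move=> gh BA [Y Yd YA]; exists (map h Y); first by rewrite size_map.
apply: leq_trans YA; apply: ntracesS => //; apply/subsetP => x.
by rewrite !inE gh; apply: contra => /map_f.
Qed.

Lemma poor_join_parts d n i f :
  poor d n f -> poor_set d n (join_parts i f) (part (join_parts i f) i) ->
  poor d n (join_parts i f).
Proof.
move=> pf pi x; have [->//|ne] := eqVneq (join_parts i f x) i.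
apply: (@poor_setS d n f _ (part f (f x)) _ (fun j => j - (i < j))) => //.
by apply/subsetP => y; move: ne; rewrite !inE /join_parts; lia.
Qed.

Variables (d n : nat).
Hypothesis n0 : 0 < n.

(** Simplicity enters the construction only here, through [simple_mergeable]. *)
Hypothesis mergeable : forall f m,
  convex_numbering f m -> 1 < m -> poor d n f ->
  exists2 i, i.+1 < m & poor_set d n (join_parts i f) (part (join_parts i f) i).

Lemma trivial_classes f : (forall x y, f x = f y) -> classes n f = one_part S.
Proof.
move=> f0; apply/esym; apply: subset_partition_eq.
- exact: one_part_partition.
- exact: classes_partition.
apply/subsetP => _ /classesP[x ->].
suff -> : [set y | key n f x == key n f y] = [set: S].
  by rewrite !inE eqxx andbT; apply/set0Pn; exists x; rewrite inE.
apply/setP => y; rewrite !inE; apply/eqP/keyP; split; first exact: f0.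
by move=> z; rewrite /tame (f0 x z) eqxx.
Qed.

(** Contraction sequences run from coarse to fine, so the sequence of the joined numbering comes
    first and is then refined to the classes of [f]. *)
Lemma merging_sequence f m :
  convex_numbering f m -> poor d n f ->
  exists s, [/\ path (@splits _ S) (one_part S) s,
    last (one_part S) s = classes n f &
    forall P, P \in one_part S :: s ->
      partition P [set: S] /\ partition_red_degree P <= red_bound Sigma d n].
Proof.
have [N] := ubnP m; elim: N m f => // N IHN m f; rewrite ltnS => mN nf pf.
have pC := classes_partition n f.
have [m1|m1] := leqP m 1.
  have e : classes n f = one_part S.
    by apply: trivial_classes => x y; have := numbering_lt nf x;
      have := numbering_lt nf y; lia.
  exists [::]; split => // P; rewrite inE => /eqP ->; rewrite -e; split => //.
  apply: (red_degree_between n0 pf pf _ pC); try exact: refines_refl.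
  by move=> j; exists j, j; rewrite setUid.
have [i im pi] := mergeable nf m1 pf.
have pg := poor_join_parts pf pi; have ng := join_parts_numbering im nf.
have [|s [ps ls als]] := IHN _ _ _ ng pg; first by lia.
have fg := @classes_refines _ S n _ _ (@join_parts_factor i f).
have [s' [ps' ls' als']] :=
  splitting_path (classes_partition n (join_parts i f)) pC fg.
exists (s ++ s'); split; first by rewrite cat_path ps ls.
  by rewrite last_cat ls.
move=> P; rewrite inE mem_cat orbA => /orP[Ps|/als'[pP Pg fP]].
  by apply: als; rewrite inE.
split=> //; apply: (red_degree_between n0 pf pg) => //.
exact: join_parts_sub.
Qed.

Let lt x y := ord_le x y && (x != y).

Let position x := rank lt [set: S] x.

Let lt_irr : irreflexive lt.
Proof. by move=> x; rewrite /lt eqxx andbF. Qed.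

Let lt_trans : transitive lt.
Proof.
have [_ le_anti le_trans _] := order_symbolP S.
move=> y x z /andP[xy nxy] /andP[yz nyz].
rewrite /lt /ord_le (le_trans _ _ _ xy yz).
by apply: contraNneq nxy => e; rewrite -e in yz; apply/eqP/le_anti/andP.
Qed.

Let lt_total x y : x \in [set: S] -> y \in [set: S] -> x != y -> lt x y || lt y x.
Proof.
have [_ _ _ le_total] := order_symbolP S.
by move=> _ _ nxy; rewrite /lt nxy [y == x]eq_sym nxy !andbT; apply: le_total.
Qed.

Lemma position_numbering : convex_numbering position #|S|.
Proof.
split=> [x|i|x y xy].
- by rewrite -cardsT; apply: rank_card => //; rewrite inE.
- by rewrite -cardsT => /(rank_onto lt_irr lt_trans lt_total)[x _ <-]; exists x.
have [->//|nxy] := eqVneq x y.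
by apply: rank_homo => //; rewrite /lt xy.
Qed.

Lemma position_inj : injective position.
Proof.
by move=> x y; apply: (rank_inj lt_irr lt_trans lt_total); rewrite inE.
Qed.

Lemma twin_width_mergeable :
  #|{: Phi}| <= n -> twin_width S <= red_bound Sigma d n.
Proof.
move=> Phin.
(* Over a single point there are at most [n] types, so singletons are poor without exceptions. *)
have pp : poor d n position.
  move=> x; exists [::] => //; apply: leq_trans Phin.
  apply: leq_trans (max_card [set atomic_type y x | y : S]).
  apply: (@leq_trans #|(fun y => atomic_type y x) @: outside position [::]|).
    apply: leq_card_imset_factor => y y' _ _ e; apply/traceP => z.
    by rewrite inE => /eqP/position_inj ->.
  by apply/subset_leq_card/imsetS/subsetP.
have [s [ps ls als]] := merging_sequence position_numbering pp.
have cs : contraction_sequence (one_part S :: s).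
  apply/and4P; split => //; first by apply/allP => P /als[].
  apply/eqP; rewrite ls; apply/setP => B.
  have kx x : [set y | key n position x == key n position y] = [set x].
    apply/setP => y; rewrite !inE; apply/eqP/eqP => [/keyP[/position_inj]//|->//].
  apply/classesP/imsetP => [[x ->]|[x _ ->]]; exists x => //.
rewrite /twin_width; case: ex_minnP => tw _ min.
apply: (@leq_trans (red_degree (one_part S :: s))).
  by apply: min; apply/asboolP; exists (one_part S :: s).
by rewrite /red_degree; apply/bigmax_leqP_seq => P /als[].
Qed.

End Merging.

(** * Rich partitions *)

Section SimpleStructures.

Variables (Sigma : ordSignature) (S : ordStructure Sigma).
Implicit Types (x y : S) (f g : S -> nat) (A B : {set S}).

Local Notation Phi := {ffun binary_symbol Sigma -> bool * bool}.

Lemma tp_Types R x A B : x \in A -> tp R x B \in Types A B.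
Proof. by move=> xA; apply: imset2_f. Qed.

Lemma TypesS A A' B B' :
  A \subset A' -> B \subset B' -> #|Types A B| <= #|Types A' B'|.
Proof.
move=> /subsetP sA /subsetP sB.
apply: (@leq_trans #|(fun T => T :&: B) @: Types A' B'|); last exact: leq_imset_card.
apply: subset_leq_card; apply/subsetP => _ /imset2P[R a _ aA ->].
apply/imsetP; exists (tp R a B'); first exact/tp_Types/sA.
apply/setP => b; rewrite !inE; case bB: (b \in B); last by rewrite andbF.
by rewrite (sB _ bB) andbT.
Qed.

Definition trace_bound (k : nat) := 2 ^ (k * #|binary_symbol Sigma|.+1).

(** The sets [tp R x B] determine the relations from [x] to [B], and the members of [Types B A] that
    contain [x] those from [B] to [x]. This leaves [k <= 2 ^ k] choices per symbol and [2 ^ k] sets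
    of types. *)
Lemma ntraces_Types k A B :
  #|Types A B| <= k -> #|Types B A| <= k -> ntraces A B <= trace_bound k.
Proof.
move=> AB BA.
pose h x : {ffun binary_symbol Sigma -> {set S}} * {set {set S}} :=
  ([ffun R => tp R x B], [set T in Types B A | x \in T]).
apply: (@leq_trans #|h @: A|).
  apply: leq_card_imset_factor => x y xA yA [/ffunP e1 /setP e2].
  apply/traceP => z zB; apply/ffunP => R; rewrite !ffunE.
  have := e1 R; rewrite !ffunE => /setP/(_ z); rewrite !inE zB /= => ->.
  by have := e2 (tp R z A); rewrite !inE tp_Types // xA yA /= => ->.
pose D := setX
    [set F : {ffun binary_symbol Sigma -> {set S}} in ffun_on (mem (Types A B))]
    (powerset (Types B A)).
apply: (@leq_trans #|D|).
  apply: subset_leq_card; apply/subsetP => _ /imsetP[x xA ->].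
  rewrite !inE /=; apply/andP; split.
    by apply/ffun_onP => R; rewrite ffunE; apply: tp_Types.
  by apply/subsetP => T; rewrite inE => /andP[].
rewrite cardsX cardsE card_ffun_on card_powerset /trace_bound mulnS addnC expnD.
rewrite leq_mul ?leq_exp2l // expnM leq_exp2r; last first.
  by apply/card_gt0P; exists (order_symbol Sigma).
by apply: leq_trans AB _; apply/ltnW/ltn_expl.
Qed.

Section Numbering.

Variables (g : S -> nat) (M k : nat).
Hypothesis ng : convex_numbering g M.

Definition wild i j : bool :=
  (k < #|Types (part g i) (part g j)|) || (k < #|Types (part g j) (part g i)|).

(** Wild intervals are ignored among the earlier ones, as they are in [ntraces_fresh]. *)
Definition fresh i j : bool :=
  ~~ wild i j &&
  [exists y in part g j, [forall y', (g y' < j) && ~~ wild i (g y') ==>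
     (trace (part g i) y' != trace (part g i) y)]].

(** Charge each type to the first interval, among those that are not wild, where it occurs. That
    interval is fresh and has at most [trace_bound k] types by [ntraces_Types]. *)
Lemma ntraces_fresh (i : nat) :
  ntraces [set y | ~~ wild i (g y)] (part g i)
    <= trace_bound k * #|[set j : 'I_M | fresh i j]|.
Proof.
set U := [set y | _]; set t := trace (part g i).
have sub : t @: U \subset \bigcup_(j : 'I_M | fresh i j) (t @: part g j).
  apply/subsetP => _ /imsetP[y0 y0U ->].
  pose P y := (y \in U) && (t y == t y0).
  have P0 : P y0 by rewrite /P y0U eqxx.
  case: (arg_minnP g P0) => y /andP[yU /eqP ty] ymin; rewrite -ty.
  apply/bigcupP; exists (Ordinal (numbering_lt ng y)) => /=; last first.
    by apply: imset_f; rewrite inE.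
  rewrite inE in yU; rewrite /fresh yU /=; apply/existsP; exists y.
  rewrite inE eqxx /=; apply/forallP => y'; apply/implyP => /andP[lt wy'].
  apply: contraL lt => /eqP e; rewrite -leqNgt; apply: ymin.
  by rewrite /P inE wy' -ty /t e eqxx.
apply: leq_trans (subset_leq_card sub) _.
have le_sum (r : seq 'I_M) (P : pred 'I_M) :
    #|\bigcup_(j <- r | P j) (t @: part g j)|
      <= \sum_(j <- r | P j) #|t @: part g j|.
  apply: (big_ind2 (fun (A : {set _}) m => #|A| <= m)) => //.
    by rewrite cards0.
  by move=> A m A' m' Am A'm; rewrite cardsU; lia.
apply: leq_trans (le_sum _ _) _.
rewrite mulnC -sum_nat_const [leqRHS](eq_bigl (fun j : 'I_M => fresh i j)); last first.
  by move=> j; rewrite inE.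
apply: leq_sum => j /andP[]; rewrite negb_or -!leqNgt => /andP[w1 w2] _.
exact: ntraces_Types.
Qed.

Lemma convex_partition_parts t (h : S -> nat) :
  convex_numbering h t ->
  let P := [set part h a | a : 'I_t] in convex_partition P /\ #|P| = t.
Proof.
move=> [ht ho hh] P; split; last first.
  rewrite card_imset ?card_ord // => a b /setP e; apply/val_inj => /=.
  have [x hx] := ho a (ltn_ord a).
  by have := e x; rewrite !inE hx eqxx => /esym/eqP.
apply/andP; split; last first.
  apply/forallP => A; apply/implyP => /imsetP[a _ ->].
  apply/forallP => x; apply/implyP; rewrite inE => /eqP xa.
  apply/forallP => z; apply/implyP; rewrite inE => /eqP za.
  apply/forallP => y; apply/implyP => /andP[/hh xy /hh yz].
  by rewrite inE eqn_leq -{1}za yz -xa xy.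
apply/and3P; split.
- rewrite eqEsubset subsetT /=; apply/subsetP => x _; apply/bigcupP.
  by exists (part h (h x)); [apply/imsetP; exists (Ordinal (ht x)) | rewrite inE].
- apply/trivIsetP => _ _ /imsetP[a _ ->] /imsetP[b _ ->] ab.
  rewrite -setI_eq0; apply: contraNT ab => /set0Pn[x]; rewrite !inE.
  by case/andP => /eqP <- /eqP ->.
- apply/imsetP => -[a _ /setP e]; have [x hx] := ho a (ltn_ord a).
  by have := e x; rewrite !inE hx eqxx.
Qed.

(** In the cell given by simplicity no pair is wild, so all its entries are fresh. Fresh points from
    its more than [trace_bound k] nonempty columns have distinct traces over the row range, as the
    later of two differs from the earlier over some part [i] of that range; this contradicts
    [ntraces_Types]. *)
Lemma grid_not_simple t (E : rel 'I_M) :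
  0 < t -> has_grid t (trace_bound k).+1 E ->
  (forall i j, E i j -> wild i j || fresh i j) -> ~ simple S k t.
Proof.
move=> t0 [rho [gam [hr hg rt gt hit]]] Ewf.
have [gM go gh] := ng.
(* Nonempty cells ensure that both divisions have exactly [t] parts. *)
have cell a b : a < t -> b < t -> exists i j : 'I_M,
    [/\ rho i = a, gam j = b & E i j].
  move=> at' bt; have := leq_trans (ltn0Sn _) (hit a b at' bt).
  rewrite card_gt0 => /set0Pn[j]; rewrite inE => /andP[/eqP gb].
  by case/existsP => i /andP[/eqP ra Eij]; exists i, j.
have nr : convex_numbering (fun x => rho (g x)) t.
  split=> [x|a at'|x y xy]; [exact: rt| |exact/hr/gh].
  have [i [_ [ra _ _]]] := cell a 0 at' t0.
  by have [x gx] := go i (ltn_ord i); exists x; rewrite gx.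
have nc : convex_numbering (fun x => gam (g x)) t.
  split=> [x|b bt|x y xy]; [exact: gt| |exact/hg/gh].
  have [_ [j [_ gb _]]] := cell 0 b t0 bt.
  by have [x gx] := go j (ltn_ord j); exists x; rewrite gx.
have [cr nrt] := convex_partition_parts nr.
have [cc nct] := convex_partition_parts nc.
move=> /(_ _ _ cr cc); rewrite nrt nct => /(_ erefl (leqnn t)).
case=> _ [_ [/imsetP[a _ ->] /imsetP[b _ ->]]].
set A := part _ a; set B := part _ b => AB BA.
have gA i : rho i = a -> part g i \subset A.
  by move=> ia; apply/subsetP => x; rewrite !inE => /eqP ->; rewrite ia.
have gB j : gam j = b -> part g j \subset B.
  by move=> jb; apply/subsetP => x; rewrite !inE => /eqP ->; rewrite jb.
have tameAB i j : rho i = a -> gam j = b -> ~~ wild i j.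
  move=> ia jb; rewrite negb_or -!leqNgt.
  rewrite (leq_trans (TypesS (gA i ia) (gB j jb))) //.
  by rewrite (leq_trans (TypesS (gB j jb) (gA i ia))).
have := ntraces_Types BA AB; rewrite leqNgt => /negP; apply.
have := hit a b (ltn_ord a) (ltn_ord b); set J := [set j | _] => /leq_trans; apply.
pose wit (j : 'I_M) y := (g y == j) &&
  [exists i : 'I_M, (rho i == a) && [forall y', (g y' < j) && ~~ wild i (g y') ==>
     (trace (part g i) y' != trace (part g i) y)]].
have ex j : j \in J -> exists y, wit j y.
  rewrite inE => /andP[/eqP jb /existsP[i /andP[/eqP ia Eij]]].
  have := Ewf i j Eij; rewrite (negbTE (tameAB i j ia jb)) /=.
  case/andP => _ /existsP[y /andP[]]; rewrite inE => gy fr.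
  by exists y; rewrite /wit gy; apply/existsP; exists i; rewrite ia eqxx.
have [x0 _] : exists x, rho (g x) = a by apply: (numbering_onto nr).
pose y_ j := odflt x0 [pick y | wit j y].
have y_P j : j \in J -> wit j (y_ j).
  by move=> /ex[y wy]; rewrite /y_; case: pickP => // /(_ y); rewrite wy.
have gy j : j \in J -> g (y_ j) = j by move=> /y_P /andP[/eqP].
have inj : {in J &, injective (fun j => trace A (y_ j))}.
  suff lt_neq j j' : j \in J -> j' \in J -> j < j' ->
      trace A (y_ j) <> trace A (y_ j').
    move=> j j' jJ j'J e; apply/val_inj.
    by case: (ltngtP j j') => // /lt_neq h; [case: (h jJ j'J) | case: (h j'J jJ)].
  move=> jJ j'J lt /traceP e.
  have /andP[_ /existsP[i /andP[/eqP ia /forallP/(_ (y_ j))]]] := y_P _ j'J.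
  rewrite gy // lt tameAB //=; last by move: jJ; rewrite inE => /andP[/eqP].
  by case/eqP; apply/traceP => x xi; apply: e; apply: (subsetP (gA i ia)).
rewrite -(card_in_imset inj); apply: subset_leq_card.
apply/subsetP => _ /imsetP[j jJ ->]; apply: imset_f; rewrite inE gy //.
by move: jJ; rewrite inE => /andP[].
Qed.

End Numbering.

Lemma simple_mergeable k t h d n s f m :
  0 < t -> 4 * (2 ^ t * (h.+1 * (trace_bound k).+1)) ^ 2 <= 2 ^ h ->
  s = (2 * grid_density t (trace_bound k).+1 h).+1 ->
  2 * s <= d -> trace_bound k * s <= n ->
  simple S k t -> convex_numbering f m -> 1 < m ->
  exists2 i, i.+1 < m & poor_set d n (join_parts i f) (part (join_parts i f) i).
Proof.
move=> t0 hh sE sd sn simp nf m1; apply: contrapT => stuck.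
(* For odd [m] the last pair is incomplete, whence [i < m./2] for the rich rows below. *)
pose g x := (f x)./2; pose M := uphalf m.
have [fm fo fh] := nf.
have ng : convex_numbering g M.
  split=> [x|i iM|x y /fh]; last by rewrite /g; lia.
    by have := fm x; rewrite /g /M; lia.
  by have [|x fx] := fo i.*2; [rewrite /M in iM; lia | exists x; rewrite /g fx; lia].
(* A part of [g] is excluded by means of two labels of the joined numbering, whence the factor 2. *)
have rich i : i < m./2 -> forall Y, 2 * size Y <= d ->
    n < ntraces (outside g Y) (part g i).
  move=> im Y Yd; rewrite ltnNge; apply/negP => YP; apply: stuck.
  exists i.*2; first by lia.
  pose mg j := j - (i.*2 < j).
  exists (map (fun j => mg j.*2) Y ++ map (fun j => mg j.*2.+1) Y).
    by rewrite size_cat !size_map; lia.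
  apply: leq_trans YP; apply: ntracesS; last first.
    by apply/subsetP => x; rewrite !inE /g /join_parts; lia.
  apply/subsetP => x; rewrite !inE mem_cat; apply: contra => gY.
  have : (f x == (g x).*2) || (f x == (g x).*2.+1) by rewrite /g; lia.
  case/orP => /eqP fE; apply/orP; [left | right]; apply/mapP; exists (g x) => //.
    by rewrite /join_parts /mg -fE.
  by rewrite /join_parts /mg -fE.
pose E : rel 'I_M := fun i j => wild g k i j || fresh g k i j.
have row (i : 'I_M) : i < m./2 -> s <= #|[set j | E i j]|.
  move=> im; pose Y := [set j : 'I_M | wild g k i j].
  have sub (P : pred 'I_M) : (forall j, P j -> E i j) ->
      #|[set j | P j]| <= #|[set j | E i j]|.
    by move=> PE; apply: subset_leq_card; apply/subsetP => j; rewrite !inE => /PE.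
  (* Either [s] intervals are wild, or the wild ones can serve as exceptions: richness then gives
     more than [trace_bound k * s] types outside them, hence at least [s] fresh intervals. *)
  have [sY|Ys] := leqP s #|Y|.
    by apply: leq_trans sY _; apply: sub => j; rewrite /E => ->.
  apply: leq_trans (sub (fun j => fresh g k i j) _); last first.
    by move=> j; rewrite /E => ->; rewrite orbT.
  have Yd : 2 * size (map val (enum Y)) <= d.
    by rewrite size_map -cardE (leq_trans _ sd) // leq_mul // ltnW.
  have := rich i im _ Yd.
  set N := ntraces _ _ => nN.
  have : N <= trace_bound k * #|[set j : 'I_M | fresh g k i j]|.
    apply: leq_trans (ntraces_fresh k ng i); apply: ntracesS => //.
    apply/subsetP => x; rewrite !inE; apply: contra => w.
    apply/mapP; exists (Ordinal (numbering_lt ng x)) => //.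
    by rewrite mem_enum inE.
  move/(leq_trans nN)/(leq_ltn_trans sn).
  by rewrite ltn_mul2l => /andP[_ /ltnW].
apply: (@grid_not_simple g M k ng t E t0 _ _ simp) => //.
apply: (dense_grid t0 _ hh) => //.
set C := grid_density _ _ _ in sE *.
have -> : #|[set p : 'I_M * 'I_M | E p.1 p.2]| = \sum_(i < M) #|[set j | E i j]|.
  rewrite -sum1_card big_mkcond /= (eq_bigr (fun p => (E p.1 p.2 : nat))).
    rewrite -(pair_bigA _ (fun i j => (E i j : nat))) /=.
    by apply: eq_bigr => i _; rewrite sum_nat_bool cardsE.
  by move=> p _; rewrite inE; case: (E _ _).
(* [s] exceeds twice the density, and at least half of the rows are rich. *)
apply: (@leq_trans (\sum_(i < M | i < m./2) s)); last first.
  rewrite [leqRHS](bigID (fun i : 'I_M => i < m./2)) /=.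
  by apply: leq_trans (leq_addr _ _); apply: leq_sum.
rewrite sum_nat_const.
have mM : m./2 <= M by rewrite /M; lia.
have le_card : m./2 <= #|[pred i : 'I_M | i < m./2]|.
  rewrite -[leqLHS]card_ord -cardsT -(@card_imset _ _ (widen_ord mM)); last first.
    by move=> i j /(congr1 val) /= /val_inj.
  apply: subset_leq_card; apply/subsetP => _ /imsetP[j _ ->].
  by rewrite inE /=.
apply: leq_trans (leq_mul le_card (leqnn s)).
have M2 : M <= 2 * m./2 by rewrite /M; lia.
apply: (@leq_ltn_trans (C * (2 * m./2))); first by rewrite leq_mul.
by rewrite sE; nia.
Qed.

End SimpleStructures.

(** * Choice of the constants *)

(** [h] is chosen to give equality once [h.+1] is replaced by [2 ^ (t + Q + 4)] and [q] by
    [2 ^ Q]. *)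
Lemma block_width_bound t Q q h :
  q <= 2 ^ Q -> h = 4 * (t + Q) + 10 ->
  4 * (2 ^ t * (h.+1 * q)) ^ 2 <= 2 ^ h.
Proof.
move=> qQ hE; have uu := ltn_expl (t + Q) (leqnn 2).
have h1 : h.+1 <= 2 ^ (t + Q + 4) by rewrite expnD; lia.
have -> : 2 ^ h = 4 * (2 ^ t * (2 ^ (t + Q + 4) * 2 ^ Q)) ^ 2.
  by rewrite -!expnD -expnM -[4]/(2 ^ 2) -expnD; congr (2 ^ _); lia.
by rewrite leq_mul2l leq_sqr !leq_mul.
Qed.

Lemma grid_density_bound t Q kappa h :
  0 < kappa -> 2 * kappa <= 2 ^ Q ->
  (2 * grid_density t kappa.+1 h).+1 <= 2 ^ (t + Q + 3 * h + 5).
Proof.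
move=> k0 kQ; have t2 : t <= 2 ^ t by apply/ltnW/ltn_expl.
have h0 : 0 < 2 ^ (t + Q + 3 * h) by rewrite expn_gt0.
suff : grid_density t kappa.+1 h <= 8 * 2 ^ (t + Q + 3 * h).
  by rewrite [2 ^ (_ + 5)]expnD; lia.
rewrite /grid_density -[8]/(2 ^ 3) -expnM 2!expnD.
rewrite [leqRHS]mulnA leq_mul2r; apply/orP; right.
have : t * kappa.+2 <= 2 ^ t * (2 * 2 ^ Q) by rewrite leq_mul //; lia.
lia.
Qed.

Lemma red_bound_le (Sigma : ordSignature) e a b :
  #|{: {ffun binary_symbol Sigma -> bool * bool}}| = 2 ^ (2 * e) ->
  red_bound Sigma (2 ^ a) (2 ^ b) <= 2 ^ (2 ^ (a + b + 2 * e + 2)).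
Proof.
move=> PhiE; rewrite /red_bound PhiE -expnM -expnM -expnD.
set d := 2 ^ a; set n := 2 ^ b; pose X := 2 * e * n.
have d0 : 0 < d by rewrite expn_gt0.
have n0 : 0 < n by rewrite expn_gt0.
apply: (@leq_trans (2 ^ (d + (X + X * d).+1))).
  rewrite (expnD 2 d) (expnS 2 (X + _)); apply: leq_mul; first exact: ltn_expl.
  exact: leqnn.
rewrite leq_exp2l //.
have -> : d + (X + X * d).+1 = d.+1 * X.+1 by rewrite mulSn !mulnS; lia.
have e2 := ltn_expl (2 * e) (leqnn 2).
have -> : a + b + 2 * e + 2 = a.+1 + (2 * e + 1 + b) by lia.
rewrite expnD [2 ^ (_ + b)]expnD; apply: leq_mul.
  by rewrite expnS -/d; lia.
apply: (@leq_trans ((2 * e).+1 * n)); first by rewrite mulSn -/X; lia.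
by rewrite leq_mul2r addn1 expnS; apply/orP; right; lia.
Qed.

Theorem theorem3p2 (Sigma : ordSignature) :
  exists c : nat,
    forall (k t : nat) (S : ordStructure Sigma),
      0 < k -> 0 < t -> simple S k t ->
      twin_width S <= 2 ^ (2 ^ (c * (k * t))).
Proof.
(* The final exponent is [26 * t + 27 * (k * e.+1) + 4 * e + 100]; bounding each term by a multiple
   of [k * t] gives this constant. *)
set e := #|binary_symbol Sigma|; exists (31 * e + 153) => k t S k0 t0 simp.
pose kappa := trace_bound Sigma k; pose Q := k * e.+1 + 1.
have kQ : 2 * kappa = 2 ^ Q by rewrite /Q addn1 expnS.
have kappa0 : 0 < kappa by rewrite expn_gt0.
pose h := 4 * (t + Q) + 10; pose a := t + Q + 3 * h + 5.
pose s := (2 * grid_density t kappa.+1 h).+1.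
have sa : s <= 2 ^ a by apply: grid_density_bound; rewrite ?kQ.
(* The summand [2 * e] makes [n] at least the number of atomic types. *)
pose d := 2 ^ a.+1; pose n := 2 ^ (a + Q + 2 * e).
have PhiE : #|{: {ffun binary_symbol Sigma -> bool * bool}}| = 2 ^ (2 * e).
  by rewrite card_ffun card_prod card_bool expnM.
have hw : 4 * (2 ^ t * (h.+1 * kappa.+1)) ^ 2 <= 2 ^ h.
  by apply: (@block_width_bound _ Q) => //; lia.
have sd : 2 * s <= d by rewrite /d expnS leq_mul.
have sn : kappa * s <= n.
  apply: (@leq_trans (2 ^ Q * 2 ^ a)); first by rewrite leq_mul // -kQ; lia.
  by rewrite -expnD leq_exp2l //; lia.
have n0 : 0 < n by rewrite expn_gt0.
have Phin : #|{: {ffun binary_symbol Sigma -> bool * bool}}| <= n.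
  by rewrite PhiE leq_exp2l // leq_addl.
have mergeable f m (nf : convex_numbering f m) (m1 : 1 < m) (_ : poor d n f) :=
  simple_mergeable t0 hw (erefl s) sd sn simp nf m1.
apply: leq_trans (twin_width_mergeable n0 mergeable Phin) _.
apply: leq_trans (red_bound_le _ _ PhiE) _.
rewrite leq_exp2l // leq_exp2l //; rewrite /a /h /Q.
have ez : k * e.+1 <= k * t * e.+1 by rewrite leq_mul2r leq_pmulr // orbT.
have tz : t <= k * t by rewrite leq_pmull.
have z0 : 0 < k * t by rewrite muln_gt0 k0.
have ez' : e <= e * (k * t) by rewrite leq_pmulr.
move: (k * t) (k * e.+1) ez tz z0 ez' => z ke; clear; lia.
Qed.
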